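(* Suppose that $A=A_{st}+A_{\mathcal I}\epsilon\in\mathbb{DC}^{n\times n}$ is a Hermitian matrix. Then there are a unitary matrix $U\in\mathbb{DC}^{n\times n}$ and a diagonal matrix $\Sigma\in\mathbb D^{n\times n}$ such that $\Sigma=U^*AU$, where $$\Sigma=\mathrm{diag}\left(\lambda_1+\lambda_{1,1}\epsilon,\cdots,\lambda_1+\lambda_{1,k_1}\epsilon,\lambda_2+\lambda_{2,1}\epsilon,\cdots,\lambda_r+\lambda_{r,k_r}\epsilon\right),$$ with the diagonal entries of $\Sigma$ being $n$ eigenvalues of $A$, $$A\mathbf u_{i,j}=(\lambda_i+\lambda_{i,j}\epsilon)\mathbf u_{i,j}$$ for $j=1,\cdots,k_i$ and $i=1,\cdots,r$, where $U=(\mathbf u_{1,1},\cdots,\mathbf u_{1,k_1},\cdots,\mathbf u_{r,k_r})$, $\lambda_1>\lambda_2>\cdots>\lambda_r$ are real numbers, $\lambda_i$ is a $k_i$-multiple eigenvalue of $A_{st}$, $\lambda_{i,1}\ge\lambda_{i,2}\ge\cdots\ge\lambda_{i,k_i}$ are also real numbers, and $\sum_{i=1}^rk_i=n$. Counting possible multiplicities of the $\lambda_{i,j}$, the form $\Sigma$ is unique (i.e. uniquely determined by $A$).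
   Context: Let $\epsilon\neq 0$ be the infinitesimal unit, $\epsilon^2=0$, commuting with complex numbers. Dual complex numbers: $\mathbb{DC}=\{q=q_{st}+q_{\mathcal I}\epsilon : q_{st},q_{\mathcal I}\in\mathbb C\}$ (a commutative ring); dual numbers: $\mathbb D=\{q_{st}+q_{\mathcal I}\epsilon: q_{st},q_{\mathcal I}\in\mathbb R\}$. The conjugate of $q$ is $\bar q=\bar q_{st}+\bar q_{\mathcal I}\epsilon$. For a matrix $A=(a_{ij})=A_{st}+A_{\mathcal I}\epsilon\in\mathbb{DC}^{m\times n}$ ($A_{st},A_{\mathcal I}$ complex matrices, the standard and infinitesimal parts), $A^*=(\bar a_{ji})$. A square matrix $A\in\mathbb{DC}^{n\times n}$ is Hermitian if $A^*=A$ and unitary if $A^*A=I_n$. A vector in $\mathbb{DC}^n$ is appreciable if at least one of its components has nonzero standard part. $\lambda\in\mathbb{DC}$ is an eigenvalue of $A$ with eigenvector $\mathbf x\in\mathbb{DC}^n$ if $\mathbf x$ is appreciable and $A\mathbf x=\lambda\mathbf x$. *)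

(* Defs.v *)
From HB Require Import structures.
From mathcomp Require Import all_boot all_order all_algebra.
From mathcomp Require Import complex.
From mathcomp Require Import reals.

Set Implicit Arguments.
Unset Strict Implicit.
Unset Printing Implicit Defensive.
Import Order.TTheory GRing.Theory Num.Theory.
Local Open Scope ring_scope.

(* [Dual a b] stands for a + b eps with eps ^+ 2 = 0.  The dual numbers are
   [dual R] and the dual complex numbers [dual R[i]], for R the reals. *)
Record dual (K : Type) : Type := Dual { dst : K; dinf : K }.

Section DualChoice.
Variable K : Type.
Definition pair_of_dual (x : dual K) : K * K := (dst x, dinf x).
Definition dual_of_pair (p : K * K) : dual K := Dual p.1 p.2.
Lemma pair_of_dualK : cancel pair_of_dual dual_of_pair.
Proof. by case. Qed.
End DualChoice.

HB.instance Definition _ (K : eqType) :=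
  Equality.copy (dual K) (can_type (@pair_of_dualK K)).
HB.instance Definition _ (K : choiceType) :=
  Choice.copy (dual K) (can_type (@pair_of_dualK K)).

Section DualRing.
Variable K : comNzRingType.
Implicit Types x y z : dual K.

Definition dual_zero : dual K := Dual 0 0.
Definition dual_one : dual K := Dual 1 0.
Definition dual_opp x : dual K := Dual (- dst x) (- dinf x).
Definition dual_add x y : dual K := Dual (dst x + dst y) (dinf x + dinf y).
Definition dual_mul x y : dual K :=
  Dual (dst x * dst y) (dst x * dinf y + dinf x * dst y).

Lemma dual_addA : associative dual_add.
Proof. by move=> x y z; rewrite /dual_add /= !addrA. Qed.
Lemma dual_addC : commutative dual_add.
Proof. by move=> x y; rewrite /dual_add addrC [dinf x + _]addrC. Qed.
Lemma dual_add0 : left_id dual_zero dual_add.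
Proof. by case=> a b; rewrite /dual_add /= !add0r. Qed.
Lemma dual_addN : left_inverse dual_zero dual_opp dual_add.
Proof. by move=> x; rewrite /dual_add /= !addNr. Qed.

HB.instance Definition _ := GRing.isZmodule.Build (dual K)
  dual_addA dual_addC dual_add0 dual_addN.

Lemma dual_mulA : associative dual_mul.
Proof.
by move=> x y z; rewrite /dual_mul /= mulrDr mulrDl !mulrA addrA.
Qed.
Lemma dual_mulC : commutative dual_mul.
Proof.
move=> x y; rewrite /dual_mul [dst x * dst y]mulrC [dst x * _]mulrC.
by rewrite [dinf x * _]mulrC addrC.
Qed.
Lemma dual_mul1 : left_id dual_one dual_mul.
Proof. by case=> a b; rewrite /dual_mul /= !mul1r mul0r addr0. Qed.
Lemma dual_mulDl : left_distributive dual_mul dual_add.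
Proof.
by move=> x y z; rewrite /dual_mul /dual_add /= !mulrDl addrACA.
Qed.
Lemma dual_oner_neq0 : dual_one != dual_zero.
Proof. by apply/eqP => -[] /eqP; rewrite oner_eq0. Qed.

HB.instance Definition _ := GRing.Zmodule_isComNzRing.Build (dual K)
  dual_mulA dual_mulC dual_mul1 dual_mulDl dual_oner_neq0.
End DualRing.

Section DualComplex.
Variable R : realType.
Local Notation DC := (dual R[i]).

Definition dual_embed (x : dual R) : DC :=
  Dual (real_complex R (dst x)) (real_complex R (dinf x)).

Definition dual_conj (x : DC) : DC := Dual (dst x)^* (dinf x)^*.

Definition st_mx m n (A : 'M[DC]_(m, n)) : 'M[R[i]]_(m, n) :=
  map_mx (@dst R[i]) A.

Definition dual_adj m n (A : 'M[DC]_(m, n)) : 'M[DC]_(n, m) :=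
  map_mx dual_conj A^T.

Definition dual_hermitian n (A : 'M[DC]_n) : Prop := dual_adj A = A.

Definition dual_unitary n (U : 'M[DC]_n) : Prop := dual_adj U *m U = 1%:M.

Definition appreciable n (x : 'cV[DC]_n) : Prop :=
  exists i : 'I_n, dst (x i 0) != 0.

Definition dual_eigenvalue n (A : 'M[DC]_n) (l : DC) : Prop :=
  exists x : 'cV[DC]_n, appreciable x /\ A *m x = l *: x.

(* Algebraic multiplicity; MathComp's [eigenvalue] is about row eigenvectors,
   which gives the same eigenvalues as column eigenvectors. *)
Definition multiple_eigenvalue n (B : 'M[R[i]]_n) (k : nat) (l : R[i]) : Prop :=
  eigenvalue B l /\ mup l (char_poly B) = k.

(* The data of Sigma: [lam] lists lambda_1, ..., lambda_r and the i-th entry of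
   [mu] lists lambda_{i,1}, ..., lambda_{i,k_i}.  So r = size lam, and
   shape mu = [:: k_1; ...; k_r]. *)
Definition spectral_data n (lam : seq R) (mu : seq (seq R)) : Prop :=
  [/\ size mu = size lam,
      all (fun k => 0 < k)%N (shape mu),
      sumn (shape mu) = n,
      sorted >%R lam
    & all (sorted >=%R) mu].

Definition spectral_entries (lam : seq R) (mu : seq (seq R)) : seq (dual R) :=
  flatten [seq [seq Dual b.1 m | m <- b.2] | b <- zip lam mu].

Definition spectral_mx n (lam : seq R) (mu : seq (seq R)) : 'M[dual R]_n :=
  diag_mx (\row_(p < n) (spectral_entries lam mu)`_p).
End DualComplex.

(* Main.v *)
Require Import Defs.
From HB Require Import structures.
From mathcomp Require Import all_boot all_order all_algebra perm.
From mathcomp Require Import complex.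
From mathcomp Require Import reals.

Set Implicit Arguments.
Unset Strict Implicit.
Unset Printing Implicit Defensive.
Import Order.TTheory GRing.Theory Num.Theory.
Local Open Scope ring_scope.
Local Open Scope sesquilinear_scope.

(** Write A = B + H eps with B and H Hermitian complex matrices.

    Existence is first-order perturbation theory. In an orthonormal eigenbasis
    of B, conjugating by 1 + X eps with X skew-Hermitian leaves the standard
    part D diagonal and adds D X - X D to the infinitesimal part; a suitable X
    removes every infinitesimal entry linking two distinct eigenvalues
    ([commutator_reduction]). What is left is Hermitian and commutes with D,
    so one complex unitary matrix diagonalizes both
    ([hermitian_diag_first_order], [dual_hermitian_diag]). The entries thus
    obtained are grouped by standard part and sorted ([exists_spectral_data]),
    and the columns of the unitary matrix are permuted accordingly.

    For uniqueness, two diagonalizations Sigma and Sigma' of A are related by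
    Sigma V = V Sigma' with V unitary. If the standard part of V_ij is nonzero,
    then Sigma_ii = Sigma'_jj ([dual_mul_cancel]). As the standard part of V is
    invertible, one of the products in the Leibniz expansion of its determinant
    is nonzero, so Sigma' is a permutation of Sigma ([dual_diag_unique]). The
    list of entries up to permutation determines the sorted data
    ([spectral_data_inj]).

    The multiplicities are read off the characteristic polynomial of B, which
    is that of the standard part of Sigma ([diag_multiple_eigenvalue]). *)

(** * Simultaneous diagonalization to first order *)

Section FirstOrder.
Variable C : numClosedFieldType.

Lemma trmxC_mul m n p (B : 'M[C]_(m, n)) (B' : 'M[C]_(n, p)) :
  (B *m B') ^t* = B' ^t* *m B ^t*.
Proof. by rewrite trmx_mul map_mxM. Qed.

Lemma conj_hermitian n (Q H : 'M[C]_n) :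
  H ^t* = H -> (Q *m H *m Q ^t*) ^t* = Q *m H *m Q ^t*.
Proof. by move=> hH; rewrite !trmxC_mul trmxCK hH mulmxA. Qed.

Lemma hermitian_trig_diag n (H : 'M[C]_n) :
  H ^t* = H -> is_trig_mx H ->
  exists2 d : 'rV[C]_n, d \is a realmx & H = diag_mx d.
Proof.
move=> hH /is_trig_mxP tH.
have hE k l : (H l k)^* = H k l by rewrite -[in RHS]hH !mxE.
exists (\row_p H p p).
  by apply/mxOverP=> i j; rewrite mxE; apply/CrealP; rewrite hE.
apply/matrixP=> i j; rewrite !mxE.
case: eqVneq => [<-|]; rewrite ?mulr1n ?mulr0n //.
rewrite neq_ltn => /orP[/tH //|/tH h].
by rewrite -hE h rmorph0.
Qed.

(** For a real diagonal D and a Hermitian H, some commutator D X - X D with X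
    skew-Hermitian removes from H every entry linking distinct diagonal entries
    of D; what remains commutes with D. *)
Lemma commutator_reduction n (d : 'rV[C]_n) (H : 'M[C]_n) :
  d \is a realmx -> H ^t* = H ->
  exists X : 'M[C]_n, exists2 E : 'M[C]_n, X ^t* = - X &
    [/\ E ^t* = E, diag_mx d *m E = E *m diag_mx d
      & H + diag_mx d *m X - X *m diag_mx d = E].
Proof.
move=> /mxOverP dR hH.
have hE k l : (H l k)^* = H k l by rewrite -[in RHS]hH !mxE.
have dC k : (d 0 k)^* = d 0 k by apply/CrealP.
(* The entry (i, j) of D X - X D is (d_i - d_j) X_ij, so this X cancels H_ij
   when d_i and d_j differ. *)
exists (\matrix_(i, j) (H i j / (d 0 j - d 0 i))).
exists (\matrix_(i, j) (if d 0 i == d 0 j then H i j else 0)).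
  apply/matrixP=> i j; rewrite !mxE rmorphM fmorphV rmorphB /= hE !dC.
  by rewrite -opprB invrN mulrN.
split.
- apply/matrixP=> i j; rewrite !mxE [d 0 j == _]eq_sym.
  by case: ifP => _; rewrite ?hE ?rmorph0.
- apply/matrixP=> i j; rewrite mul_diag_mx mul_mx_diag !mxE.
  by case: eqP => [->|_]; rewrite ?mulr0 ?mul0r // mulrC.
apply/matrixP=> i j; rewrite mul_diag_mx mul_mx_diag !mxE.
case: eqVneq => [->|nd]; first by rewrite [d 0 j * _]mulrC addrK.
have nd' : d 0 j - d 0 i != 0 by rewrite subr_eq0 eq_sym.
rewrite -addrA [_ * d 0 j]mulrC -mulrBl -opprB mulNr mulrC divfK //.
exact: subrr.
Qed.

(** The standard and infinitesimal parts of the equations saying that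
    U0 + U1 eps is unitary and diagonalizes the Hermitian matrix B + H eps. *)
Lemma hermitian_diag_first_order n (B H : 'M[C]_n) :
  B ^t* = B -> H ^t* = H ->
  exists (U0 U1 : 'M[C]_n) (d e : 'rV[C]_n),
  [/\ d \is a realmx, e \is a realmx,
     U0 ^t* *m U0 = 1%:M /\ U0 ^t* *m U1 + U1 ^t* *m U0 = 0,
     U0 ^t* *m B *m U0 = diag_mx d
   & U0 ^t* *m B *m U1 + (U0 ^t* *m H + U1 ^t* *m B) *m U0 = diag_mx e].
Proof.
move=> hB hH.
have Bherm : B \is hermsymmx by apply/is_hermitianmxP; rewrite expr0 scale1r.
pose P := spectralmx B; pose d0 := spectral_diag B.
have PU : P \is unitarymx := spectral_unitarymx B.
have PE : P *m B *m P ^t* = diag_mx d0.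
  have /hermitian_normalmx/orthomx_spectralP {1}-> := Bherm.
  rewrite -invmx_unitary // !mulmxA mulmxV ?unitarymx_unit // mul1mx.
  by rewrite mulmxK ?unitarymx_unit.
have dR : d0 \is a realmx := hermitian_spectral_diag_real Bherm.
have [X [E hX [hE DE HE]]] := commutator_reduction dR (conj_hermitian P hH).
have [Q QU /andP[]] := cotrigonalization2 DE.
rewrite /similar_to !conjymx //= => tD tE.
have hD : (diag_mx d0) ^t* = diag_mx d0.
  by rewrite tr_diag_mx map_diag_mx realmxC.
have [d dreal dE] := hermitian_trig_diag (conj_hermitian Q hD) tD.
have [e ereal eE] := hermitian_trig_diag (conj_hermitian Q hE) tE.
have QQt := unitarymxP QU; have PPt := unitarymxP PU.
(* This is the product P^* (1 + X eps) Q^*. *)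
exists (P ^t* *m Q ^t*), (P ^t* *m X *m Q ^t*), d, e; split=> //.
- rewrite !trmxC_mul !trmxCK hX; split.
    by rewrite mulmxA -(mulmxA Q) PPt mulmx1.
  rewrite !mulmxA -(mulmxA Q P) -(mulmxA (Q *m - X) P) PPt !mulmx1.
  by rewrite mulmxN mulNmx subrr.
- by rewrite trmxC_mul !trmxCK -dE -PE !mulmxA.
rewrite !trmxC_mul !trmxCK hX -eE -HE -PE.
rewrite !(mulmxDr, mulmxDl, mulmxN, mulNmx) !mulmxA.
by rewrite addrA [X in X - _]addrC.
Qed.

End FirstOrder.

(** * Matrices over the dual complex numbers *)

Section DualMatrix.
Variable R : realType.
Local Notation C := (R[i]).
Local Notation DC := (dual C).

(** The matrix B + H eps with standard part B and infinitesimal part H. *)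
Definition dual_mx m n (B H : 'M[C]_(m, n)) : 'M[DC]_(m, n) :=
  \matrix_(i, j) Dual (B i j) (H i j).

(** The infinitesimal part of a matrix, the counterpart of [st_mx]. *)
Definition inf_mx m n (A : 'M[DC]_(m, n)) : 'M[C]_(m, n) :=
  map_mx (@dinf C) A.

Lemma dual_mxK m n (A : 'M[DC]_(m, n)) : dual_mx (st_mx A) (inf_mx A) = A.
Proof. by apply/matrixP=> i j; rewrite !mxE; case: (A i j). Qed.

Lemma st_dual_mx m n (B H : 'M[C]_(m, n)) : st_mx (dual_mx B H) = B.
Proof. by apply/matrixP=> i j; rewrite !mxE. Qed.

Lemma inf_dual_mx m n (B H : 'M[C]_(m, n)) : inf_mx (dual_mx B H) = H.
Proof. by apply/matrixP=> i j; rewrite !mxE. Qed.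

Lemma dst_sum (I : finType) (F : I -> DC) :
  dst (\sum_i F i) = \sum_i dst (F i).
Proof. exact: (big_morph (@dst C)). Qed.

Lemma dinf_sum (I : finType) (F : I -> DC) :
  dinf (\sum_i F i) = \sum_i dinf (F i).
Proof. exact: (big_morph (@dinf C)). Qed.

Lemma mul_dual_mx m n p (B H : 'M[C]_(m, n)) (B' H' : 'M[C]_(n, p)) :
  dual_mx B H *m dual_mx B' H' = dual_mx (B *m B') (B *m H' + H *m B').
Proof.
apply/matrixP=> i j; rewrite !mxE -big_split /=.
rewrite [LHS](_ : _ = Dual (dst (\sum_k dual_mx B H i k * dual_mx B' H' k j))
  (dinf (\sum_k dual_mx B H i k * dual_mx B' H' k j))); last by case: (\sum_k _).
rewrite dst_sum dinf_sum; congr Dual; apply: eq_bigr => k _; by rewrite !mxE.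
Qed.

Lemma st_mxM m n p (A : 'M[DC]_(m, n)) (B : 'M[DC]_(n, p)) :
  st_mx (A *m B) = st_mx A *m st_mx B.
Proof. by rewrite -{1}(dual_mxK A) -{1}(dual_mxK B) mul_dual_mx st_dual_mx. Qed.

Lemma st_mx1 n : st_mx (1%:M : 'M[DC]_n) = 1%:M.
Proof. by apply/matrixP=> i j; rewrite !mxE; case: (i == j). Qed.

Lemma inf_mx1 n : inf_mx (1%:M : 'M[DC]_n) = 0.
Proof. by apply/matrixP=> i j; rewrite !mxE; case: (i == j). Qed.

Lemma dual_mx1 n : dual_mx 1%:M 0 = 1%:M :> 'M[DC]_n.
Proof. by rewrite -[RHS]dual_mxK st_mx1 inf_mx1. Qed.

Lemma adj_dual_mx m n (B H : 'M[C]_(m, n)) :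
  dual_adj (dual_mx B H) = dual_mx (B ^t*) (H ^t*).
Proof. by apply/matrixP=> i j; rewrite !mxE. Qed.

Lemma dual_unitary_colperm n (U : 'M[DC]_n) (s : 'S_n) :
  dual_unitary U -> dual_unitary (col_perm s U).
Proof.
move=> /matrixP hU; apply/matrixP=> i j.
transitivity ((1%:M : 'M[DC]_n) (s i) (s j)); last first.
  by rewrite !mxE (inj_eq perm_inj).
by rewrite -hU !mxE; apply: eq_bigr => k _; rewrite !mxE.
Qed.

Lemma conj_colperm n (A U : 'M[DC]_n) (s : 'S_n) i j :
  (dual_adj (col_perm s U) *m A *m col_perm s U) i j =
  (dual_adj U *m A *m U) (s i) (s j).
Proof.
rewrite [LHS]mxE [RHS]mxE; apply: eq_bigr => k _.
rewrite [col_perm s U k j]mxE; congr (_ * _).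
by rewrite [LHS]mxE [RHS]mxE; apply: eq_bigr => l _; rewrite /dual_adj !mxE.
Qed.

(** Every Hermitian dual complex matrix is unitarily diagonalizable, with dual
    real diagonal entries in no particular order. *)
Lemma dual_hermitian_diag n (A : 'M[DC]_n) :
  dual_hermitian A ->
  exists (U : 'M[DC]_n) (t : 'I_n -> dual R), dual_unitary U /\
    dual_adj U *m A *m U = diag_mx (\row_p dual_embed (t p)).
Proof.
move=> hA; set B := st_mx A; set H := inf_mx A.
have [hB hH] : B ^t* = B /\ H ^t* = H.
  have := hA; rewrite /dual_hermitian -(dual_mxK A) adj_dual_mx => e.
  have := congr1 (@inf_mx _ _) e; rewrite !inf_dual_mx => ->.
  by have := congr1 (@st_mx _ _ _) e; rewrite !st_dual_mx => ->.
have [U0 [U1 [d [e [dR eR [UU0 UU1] dE eE]]]]] :=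
  hermitian_diag_first_order hB hH.
exists (dual_mx U0 U1).
exists (fun p => Dual (complex.Re (d 0 p)) (complex.Re (e 0 p))); split.
  by rewrite /dual_unitary adj_dual_mx mul_dual_mx UU0 UU1 dual_mx1.
rewrite -(dual_mxK A) adj_dual_mx !mul_dual_mx dE eE.
apply/matrixP=> i j; rewrite !mxE /dual_embed /=.
rewrite !RRe_real ?(mxOverP dR) ?(mxOverP eR) //.
by case: (i == j); rewrite ?mulr1n ?mulr0n.
Qed.

End DualMatrix.

(** * Spectral data and their lists of diagonal entries *)

Section SpectralEntries.
Variable R : realType.
Implicit Types (lam : seq R) (mu : seq (seq R)) (s : seq (dual R)).

Lemma shape_spectral_entries lam mu : size mu = size lam ->
  shape [seq [seq Dual b.1 m | m <- b.2] | b <- zip lam mu] = shape mu.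
Proof.
elim: lam mu => [|l lam IH] [|m mu] //= [] /IH; rewrite /shape => e.
by congr (_ :: _); rewrite ?size_map.
Qed.

Lemma size_spectral_entries lam mu : size mu = size lam ->
  size (spectral_entries lam mu) = sumn (shape mu).
Proof. by move=> h; rewrite size_flatten shape_spectral_entries. Qed.

Lemma nth_spectral_entries lam mu i j : size mu = size lam ->
  (i < size lam)%N -> (j < size (nth [::] mu i))%N ->
  (spectral_entries lam mu)`_(flatten_index (shape mu) i j) =
    Dual lam`_i (nth [::] mu i)`_j.
Proof.
move=> h hi hj; rewrite /spectral_entries nth_flatten shape_spectral_entries //.
have hj' : (j < nth 0 (shape mu) i)%N.
  by rewrite (nth_map [::]) // h.
rewrite flatten_indexKl // flatten_indexKr //.
rewrite (nth_map (0, [::])) ?size_zip ?h ?minnn // nth_zip ?h //=.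
by rewrite (nth_map 0).
Qed.

Lemma dst_spectral_entries lam mu x :
  x \in spectral_entries lam mu -> dst x \in lam.
Proof.
elim: lam mu => [|l lam IH] [|m mu] //=; rewrite /spectral_entries /= mem_cat.
case/orP => [/mapP[y _ ->]|/IH]; rewrite inE ?eqxx // => ->.
by rewrite orbT.
Qed.

Lemma mem_dst_spectral_entries lam mu : size mu = size lam ->
  all (fun k => 0 < k)%N (shape mu) ->
  [seq dst x | x <- spectral_entries lam mu] =i lam.
Proof.
move=> + + l; elim: lam mu => [|l' lam IH] [|m mu] //= [hs] /andP[hm hmu].
rewrite /spectral_entries /= map_cat mem_cat -/(spectral_entries lam mu).
rewrite IH // inE; congr (_ || _).
case: m hm => //= y m _; rewrite inE; case: eqVneq => //= ne.
by apply/negP => /mapP[? /mapP[z _ ->] /= e]; rewrite e eqxx in ne.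
Qed.

(** The i-th block is recovered from the list of entries as the sublist of
    those with standard part lambda_i. *)
Lemma filter_spectral_entries lam mu i : size mu = size lam -> uniq lam ->
  (i < size lam)%N ->
  [seq x <- spectral_entries lam mu | dst x == lam`_i] =
    [seq Dual lam`_i m | m <- nth [::] mu i].
Proof.
elim: lam mu i => [|l lam IH] [|m mu] //= i [hs] /andP[hl hu] hi.
rewrite /spectral_entries /= filter_cat -/(spectral_entries lam mu).
case: i hi => [|i] /= hi.
  rewrite -[RHS]cats0; congr (_ ++ _).
    by apply/all_filterP/allP => _ /mapP[y _ ->] /=.
  rewrite -(filter_pred0 (spectral_entries lam mu)).
  apply: eq_in_filter => x /dst_spectral_entries hx.
  by apply/eqP => e; rewrite -e hx in hl.
rewrite IH // -[RHS]cat0s; congr (_ ++ _).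
rewrite -(filter_pred0 [seq Dual l m | m <- m]).
apply: eq_in_filter => _ /mapP[y _ ->] /=.
by apply/eqP => e; rewrite e mem_nth in hl.
Qed.

Lemma ge_trans : transitive (>=%R : rel R).
Proof. by move=> y x z /= h1 h2; exact: le_trans h2 h1. Qed.

Lemma gt_sorted_uniq lam : sorted >%R lam -> uniq lam.
Proof.
apply: sorted_uniq => [y x z /= h1 h2|x]; last exact: ltxx.
exact: lt_trans h2 h1.
Qed.

Lemma spectral_data_inj n n' lam mu lam' mu' :
  spectral_data n lam mu -> spectral_data n' lam' mu' ->
  perm_eq (spectral_entries lam mu) (spectral_entries lam' mu') ->
  lam = lam' /\ mu = mu'.
Proof.
move=> [hs hp _ hl hm] [hs' hp' _ hl' hm'] hperm.
have lamE : lam = lam'.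
  apply: (irr_sorted_eq (leT := >%R)) => // [y x z /= h1 h2|x|x].
  - exact: lt_trans h2 h1.
  - exact: ltxx.
  - rewrite -(mem_dst_spectral_entries hs hp).
    rewrite -(mem_dst_spectral_entries hs' hp').
    exact/perm_mem/perm_map.
subst lam'; split=> //.
apply: (@eq_from_nth _ [::]) => [|i hi]; first by rewrite hs hs'.
have hi' : (i < size lam)%N by rewrite -hs.
apply: (sorted_eq ge_trans).
- by move=> x y /= /le_anti.
- by apply: (allP hm); rewrite mem_nth.
- by apply: (allP hm'); rewrite mem_nth // hs' -hs.
have hu := gt_sorted_uniq hl.
have := perm_map (@dinf R) (perm_filter (fun x => dst x == lam`_i) hperm).
by rewrite !filter_spectral_entries // -!map_comp !map_id.
Qed.

(** Grouping the elements of s by standard part only permutes them. *)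
Lemma perm_flatten_filter (lam : seq R) s : uniq lam ->
  perm_eq (flatten [seq [seq x <- s | dst x == l] | l <- lam])
          [seq x <- s | dst x \in lam].
Proof.
elim: lam => [|l lam IH] /=.
  by rewrite (eq_filter (a2 := pred0)) ?filter_pred0.
case/andP => hl /IH {}IH.
apply/seq.permP => a; rewrite count_cat (seq.permP IH) !count_filter.
rewrite -count_predUI [X in (_ + X)%N](_ : _ = 0)%N ?addn0.
  by apply: eq_count => x /=; rewrite inE andb_orr.
apply/eqP; rewrite -leqn0 leqNgt -has_count; apply/hasP => -[x _ /=].
by case/andP => /andP[_ /eqP ->] /andP[_]; exact/negP.
Qed.

Lemma exists_spectral_data s : exists lam mu,
  spectral_data (size s) lam mu /\ perm_eq (spectral_entries lam mu) s.
Proof.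
pose lam : seq R := sort >=%R (undup (map (@dst R) s)).
pose mu := [seq sort >=%R [seq dinf x | x <- s & dst x == l] | l <- lam].
have hs : size mu = size lam by rewrite size_map.
have ge_total : total (>=%R : rel R) by move=> x y /=; exact: le_total.
have hu : uniq lam by rewrite sort_uniq undup_uniq.
have mem_lam x : x \in s -> dst x \in lam.
  by move=> hx; rewrite mem_sort mem_undup map_f.
have hperm : perm_eq (spectral_entries lam mu) s.
  have -> : spectral_entries lam mu = flatten [seq [seq Dual l m | m <-
      sort >=%R [seq dinf x | x <- s & dst x == l]] | l <- lam].
    rewrite /spectral_entries /mu; congr flatten.
    by elim: (lam) => //= l lam' ->.
  apply: (@perm_trans _ [seq x <- s | dst x \in lam]); last first.
    by rewrite (all_filterP _) //; apply/allP.
  apply: perm_trans (perm_flatten_filter s hu).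
  elim: (lam) => //= l lam'; apply: perm_cat.
  apply: perm_trans (perm_map _ (permEl (perm_sort _ _))) _.
  rewrite -map_comp (eq_in_map _ id _).1 ?map_id // => -[a b] /=.
  by rewrite mem_filter /= => /andP[/eqP ->].
exists lam, mu; split=> //; split=> //.
- apply/allP => _ /mapP[_ /mapP[l hl ->] ->].
  rewrite size_sort size_map size_filter -has_count.
  move: hl; rewrite mem_sort mem_undup => /mapP[x hx ->].
  by apply/hasP; exists x.
- by rewrite -(size_spectral_entries hs) (perm_size hperm).
- have : sorted >=%R lam by apply: sort_sorted.
  move: hu; rewrite !(sorted_pairwise ge_trans) uniq_pairwise => h1 h2.
  have gt_trans : transitive (>%R : rel R).
    by move=> y x z /= h h'; exact: lt_trans h' h.
  rewrite (sorted_pairwise gt_trans).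
  have : pairwise [rel x y | (x != y) && (y <= x)] lam.
    by rewrite pairwise_relI; apply/andP; split; [exact: h1|exact: h2].
  apply: sub_pairwise => x y /= /andP[nxy].
  by rewrite lt_neqAle eq_sym nxy.
by apply/allP => _ /mapP[l _ ->]; apply: sort_sorted.
Qed.

End SpectralEntries.

(** * Uniqueness of the diagonal entries and multiplicities *)

Lemma det_neq0_perm (F : comNzRingType) n (M : 'M[F]_n) :
  \det M != 0 -> exists s : 'S_n, forall i, M i (s i) != 0.
Proof.
move=> hM; have [/existsP[s /forallP hs]|] :=
  boolP [exists s : 'S_n, [forall i, M i (s i) != 0]]; first by exists s.
rewrite negb_exists => /forallP h; case/eqP: hM; apply: big1 => s _.
have := h s; rewrite negb_forall => /existsP[i /negPn/eqP hi].
by rewrite (bigD1 i) //= hi mul0r mulr0.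
Qed.

Lemma char_poly_conj (F : comNzRingType) n (P Q B : 'M[F]_n) :
  P *m Q = 1%:M -> char_poly (Q *m B *m P) = char_poly B.
Proof.
move=> PQ; have QP := mulmx1C PQ.
have -> : char_poly (Q *m B *m P) =
    \det (map_mx polyC Q *m char_poly_mx B *m map_mx polyC P).
  congr (\det _); rewrite /char_poly_mx mulmxBr mulmxBl !map_mxM /=.
  by rewrite mul_mx_scalar -scalemxAl -(map_mxM _ Q P) QP map_mx1 scalemx1.
rewrite !det_mulmx mulrC mulrA -det_mulmx -(map_mxM _ P Q) PQ.
by rewrite map_mx1 det1 mul1r.
Qed.

Section Uniqueness.
Variable R : realType.
Local Notation DC := (dual R[i]).

Lemma dual_unitaryC n (U : 'M[DC]_n) :
  dual_unitary U -> U *m dual_adj U = 1%:M.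
Proof. exact: mulmx1C. Qed.

Lemma dual_embed_inj : injective (@dual_embed R).
Proof. by move=> [a b] [a' b'] [-> ->]. Qed.

(** This is the entrywise form of Sigma V = V Sigma' for diagonal Sigma and
    Sigma'; a dual number with nonzero standard part can be cancelled. *)
Lemma dual_mul_cancel (x y v : DC) : x * v = v * y -> dst v != 0 -> x = y.
Proof.
case: x y v => [a b] [a' b'] [v w] /= [e1 e2] hv.
have ea : a = a' by apply: (mulIf hv); rewrite e1 mulrC.
rewrite -ea; congr Dual; apply: (mulIf hv).
by apply: (addrI (a * w)); rewrite e2 -ea addrC [w * a]mulrC [v * b']mulrC.
Qed.

Lemma dual_diag_unique n (A U U' : 'M[DC]_n) (t t' : 'I_n -> dual R) :
  dual_unitary U -> dual_unitary U' ->
  dual_adj U *m A *m U = diag_mx (\row_p dual_embed (t p)) ->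
  dual_adj U' *m A *m U' = diag_mx (\row_p dual_embed (t' p)) ->
  exists s : 'S_n, forall i, t i = t' (s i).
Proof.
move=> hU hU' dU dU'; pose V := dual_adj U *m U'.
have VE : diag_mx (\row_p dual_embed (t p)) *m V =
          V *m diag_mx (\row_p dual_embed (t' p)).
  rewrite -dU -dU' /V.
  move: (dual_adj U) (dual_adj U') (dual_unitaryC hU) (dual_unitaryC hU').
  move=> W W' UW UW'.
  by rewrite -!mulmxA (mulmxA U) UW mul1mx (mulmxA U') UW' mul1mx.
have detV : \det (st_mx V) != 0.
  rewrite -unitfE -unitmxE /V st_mxM unitmx_mul; apply/andP; split.
    have := congr1 (@st_mx _ _ _) hU; rewrite st_mxM st_mx1.
    by case/mulmx1_unit.
  have := congr1 (@st_mx _ _ _) hU'; rewrite st_mxM st_mx1.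
  by case/mulmx1_unit.
have [s hs] := det_neq0_perm detV; exists s => i; apply: dual_embed_inj.
have := hs i; rewrite mxE; apply: dual_mul_cancel.
have := congr1 (fun M : 'M_n => M i (s i)) VE.
by rewrite /= mul_diag_mx mul_mx_diag !mxE.
Qed.

Lemma map_spectral_mx n (lam : seq R) (mu : seq (seq R)) :
  map_mx (@dual_embed R) (spectral_mx n lam mu) =
  diag_mx (\row_(p < n) dual_embed (spectral_entries lam mu)`_p).
Proof.
apply/matrixP=> i j; rewrite !mxE.
by case: (i == j); rewrite ?mulr1n ?mulr0n.
Qed.

Lemma spectral_data_unique n (A U U' : 'M[DC]_n) (lam lam' : seq R)
    (mu mu' : seq (seq R)) :
  dual_unitary U -> spectral_data n lam mu ->
  map_mx (@dual_embed R) (spectral_mx n lam mu) = dual_adj U *m A *m U ->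
  dual_unitary U' -> spectral_data n lam' mu' ->
  map_mx (@dual_embed R) (spectral_mx n lam' mu') = dual_adj U' *m A *m U' ->
  lam = lam' /\ mu = mu'.
Proof.
move=> hU hd + hU' hd'; rewrite !map_spectral_mx => dU dU'.
have [s hs] := dual_diag_unique hU hU' (esym dU) (esym dU').
apply: (spectral_data_inj hd hd').
have sz : size (spectral_entries lam mu) == n.
  by case: hd => h1 _ <- _ _; rewrite size_spectral_entries.
have sz' : size (spectral_entries lam' mu') == n.
  by case: hd' => h1 _ <- _ _; rewrite size_spectral_entries.
apply/(@tuple_permP _ _ _ (Tuple sz')); exists s.
apply: (@eq_from_nth _ 0) => [|i hi]; first by rewrite (eqP sz) size_tuple.
rewrite (eqP sz) in hi; rewrite -[RHS](tnth_nth 0 _ (Ordinal hi)) tnth_mktuple.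
by rewrite (tnth_nth 0) /= -hs.
Qed.

Lemma diag_multiple_eigenvalue n (A U : 'M[DC]_n) (lam : seq R)
    (mu : seq (seq R)) i :
  dual_unitary U -> spectral_data n lam mu ->
  map_mx (@dual_embed R) (spectral_mx n lam mu) = dual_adj U *m A *m U ->
  (i < size lam)%N ->
  multiple_eigenvalue (st_mx A) (size (nth [::] mu i)) (real_complex R lam`_i).
Proof.
move=> hU [h1 h2 h3 h4 h5] dU hi.
set s := spectral_entries lam mu.
have sz : size s = n by rewrite size_spectral_entries.
have cE : char_poly (st_mx A) =
    \prod_(y <- [seq real_complex R (dst x) | x <- s]) ('X - y%:P).
  have UU : st_mx U *m st_mx (dual_adj U) = 1%:M.
    by rewrite -st_mxM dual_unitaryC // st_mx1.
  rewrite -(char_poly_conj _ UU) -!st_mxM -dU map_spectral_mx.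
  rewrite char_poly_trig; last first.
    apply/is_trig_mxP => k l kl; rewrite !mxE.
    by case: eqVneq kl => [->|]; rewrite ?ltnn ?mulr0n.
  rewrite big_map (big_nth 0) sz big_mkord; apply: eq_bigr => p _.
  by rewrite !mxE eqxx mulr1n.
have mE : mup (real_complex R lam`_i) (char_poly (st_mx A)) =
    size (nth [::] mu i).
  rewrite cE mu_prod_XsubC count_map.
  rewrite -(size_map (Dual lam`_i)) -filter_spectral_entries ?gt_sorted_uniq //.
  rewrite size_filter; apply: eq_count => x /=.
  by rewrite (inj_eq (@complexI R)).
split=> //; rewrite eigenvalue_root_char -dvdp_XsubCl XsubC_dvd ?mE.
  by apply: (allP h2); apply/mapP; exists (nth [::] mu i); rewrite ?mem_nth ?h1.
exact/monic_neq0/char_poly_monic.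
Qed.

End Uniqueness.

(** * The spectral theorem *)

Theorem theorem4p4 (R : realType) (n : nat) (A : 'M[dual R[i]]_n) :
  dual_hermitian A ->
  exists (U : 'M[dual R[i]]_n) (lam : seq R) (mu : seq (seq R)),
    let Sigma : 'M[dual R]_n := spectral_mx n lam mu in
    let r := size lam in
    let k i := size (nth [::] mu i) in
    [/\ dual_unitary U,
        spectral_data n lam mu,
        map_mx (@dual_embed R) Sigma = dual_adj U *m A *m U
      & [/\ forall p : 'I_n, dual_eigenvalue A (dual_embed (Sigma p p)),
            forall i j (p : 'I_n), (i < r)%N -> (j < k i)%N ->
              p = flatten_index (shape mu) i j :> nat ->
              A *m col p U =
                dual_embed (Dual lam`_i (nth [::] mu i)`_j) *: col p U
          & forall i, (i < r)%N ->
              multiple_eigenvalue (st_mx A) (k i) (real_complex R lam`_i)]]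
    /\ forall (U' : 'M[dual R[i]]_n) (lam' : seq R) (mu' : seq (seq R)),
         dual_unitary U' ->
         spectral_data n lam' mu' ->
         map_mx (@dual_embed R) (spectral_mx n lam' mu') =
           dual_adj U' *m A *m U' ->
         [/\ spectral_mx n lam' mu' = Sigma, lam' = lam & mu' = mu].
Proof.
move=> hA.
have [V [t [hV dV]]] := dual_hermitian_diag hA.
have [lam [mu [hd hperm]]] := exists_spectral_data (codom t).
rewrite size_codom card_ord in hd.
have [hs _ hn _ _] := hd.
have sz : size (spectral_entries lam mu) = n by rewrite size_spectral_entries.
have szt : size (codom t) == n by rewrite size_codom card_ord.
have [s hsE] := (@tuple_permP _ _ _ (Tuple szt) hperm).
have entE (p : 'I_n) : (spectral_entries lam mu)`_p = t (s p).
  have -> : (spectral_entries lam mu)`_p =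
      tnth [tuple tnth (Tuple szt) (s i) | i < n] p by rewrite (tnth_nth 0) -hsE.
  rewrite tnth_mktuple (tnth_nth 0) /= codomE (nth_map p) ?size_enum_ord //.
  by rewrite nth_ord_enum.
pose U := col_perm s V.
have hU : dual_unitary U := dual_unitary_colperm s hV.
have dU : map_mx (@dual_embed R) (spectral_mx n lam mu) =
    dual_adj U *m A *m U.
  rewrite map_spectral_mx; apply/matrixP=> i j.
  rewrite conj_colperm dV !mxE (inj_eq perm_inj).
  by case: eqVneq => [->|_]; rewrite ?mulr0n // !mulr1n entE.
have eigU (p : 'I_n) : A *m col p U =
    dual_embed (spectral_entries lam mu)`_p *: col p U.
  have AU : A *m U = U *m map_mx (@dual_embed R) (spectral_mx n lam mu).
    rewrite dU; move: (dual_adj U) (dual_unitaryC hU) => W UW.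
    by rewrite !mulmxA UW mul1mx.
  rewrite map_spectral_mx mul_mx_diag in AU.
  apply/matrixP=> i j; have := congr1 (fun M : 'M_n => M i p) AU.
  by rewrite !mxE mulrC => <-; apply: eq_bigr => k _; rewrite !mxE.
have appU (p : 'I_n) : appreciable (col p U).
  have [/existsP[i hi]|] := boolP [exists i, dst (col p U i 0) != 0].
    by exists i.
  rewrite negb_exists => /forallP h0.
  have /matrixP/(_ p p) := congr1 (@st_mx _ _ _) hU.
  rewrite st_mxM st_mx1 !mxE eqxx big1 => [/eqP|k _].
    by rewrite eq_sym oner_eq0.
  have := h0 k; rewrite negbK mxE => /eqP; rewrite [st_mx U k p]mxE => ->.
  by rewrite mulr0.
exists U, lam, mu; split=> [|U' lam' mu' hU' hd' dU']; last first.
  have [-> ->] := spectral_data_unique hU hd dU hU' hd' dU'.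
  by split.
split=> //; split.
- move=> p; exists (col p U); split=> //.
  by rewrite eigU !mxE eqxx mulr1n.
- by move=> i j p hi hj hp; rewrite eigU hp nth_spectral_entries.
- by move=> i hi; exact: diag_multiple_eigenvalue hU hd dU hi.
Qed.
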